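(* Let $P_1,\dots,P_N\in\mathbb C[z_1,\dots,z_d]$ be nonzero polynomials, and let $\delta_1,\dots,\delta_N>0$ and $R>0$ be real numbers such that \[ \sum_{k=1}^N \delta_k^2\deg P_k\le R^2 . \] Then there exists a point in the ball $B^{2d}(R)\subset\mathbb C^d$ which, for all $k=1,\dots,N$, is at Euclidean distance at least $\delta_k$ from the zero set of $P_k$ in $\mathbb C^d$.
   Context: $B^{2d}(R)=\{z\in\mathbb C^d : |z|\le R\}$ is the closed ball of radius $R>0$ centered at the origin, where $|z|^2=|z_1|^2+\dots+|z_d|^2$. $\deg P$ is the total degree. The distance from a point to a set is the infimum of distances to its points; the distance to the empty set is $+\infty$. *)

(* Defs.v *)
From mathcomp Require Import all_boot all_order all_algebra.
From mathcomp Require Import all_classical all_reals ereal.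
From mathcomp Require Import complex.
(* The notations of mpoly clash with those of mathcomp-analysis. *)
From mathcomp Require Import -(notations) mpoly.

Set Implicit Arguments.
Unset Strict Implicit.
Unset Printing Implicit Defensive.

Import Order.TTheory GRing.Theory Num.Theory.

Local Open Scope classical_set_scope.
Local Open Scope ring_scope.

(* The matrix library's own norm on row vectors is the sup norm, hence this
   definition; [normc] is the modulus with values in [R] rather than [R[i]]. *)
Definition eucl_norm (R : realType) (d : nat) (z : 'rV[R[i]]_d) : R :=
  Num.sqrt (\sum_(i < d) ComplexField.Normc.normc (z 0 i) ^+ 2).

Definition eucl_ball (R : realType) (d : nat) (r : R) : set 'rV[R[i]]_d :=
  [set z | eucl_norm z <= r].
Arguments eucl_ball {R} d r.

(* The value is [+oo] when [A] is empty ([ereal_inf0]). *)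
Definition eucl_dist (R : realType) (d : nat)
    (z : 'rV[R[i]]_d) (A : set 'rV[R[i]]_d) : \bar R :=
  ereal_inf [set (eucl_norm (z - w))%:E | w in A].

(* [msize] is one more than the total degree of a nonzero polynomial. *)
Definition total_degree (R : realType) (d : nat)
    (p : mpoly d R[i]) : nat := (msize p).-1.

Definition zero_set (R : realType) (d : nat)
    (p : mpoly d R[i]) : set 'rV[R[i]]_d :=
  [set z | meval (z 0) p = 0].

(* Main.v *)
(* Put a_k = delta_k^2 and let z maximize, on the ball of radius r, the function
   F = prod_k |P_k|^(a_k) exp(-|z|^2/2).  By the maximum principle at infinity
   on complex lines through the origin, prod_k |P_k|^(a_k) grows at most like
   |z|^(sum_k a_k deg P_k) <= |z|^(r^2) outside the ball, so z maximizes F on all of C^d.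
   If P_k vanished at w with |z - w| = l < delta_k, divide out the corresponding
   zero on the line through w and z: on the disc of radius delta_k around w, the
   gaussian agrees on the boundary circle with the exponential of a harmonic
   function, and the maximum principle at z gives
   log(delta_k / l) <= (1 - l^2/delta_k^2)/2, which is false.
   Since the exponents a_k are real, the maximum principle is proved for products
   prod_k |q_k|^(a_k) |exp(b t)|, by comparing the value at a point c with the
   product of the values at the four points c + i^j s, which is at least the
   fourth power of the value at c up to a factor exp(- C s^4). *)
Require Import Defs.
From mathcomp Require Import all_boot all_order all_algebra.
From mathcomp Require Import all_classical all_reals ereal.
From mathcomp Require Import topology normedtype sequences derive realfun exp.
From mathcomp Require Import complex.
From mathcomp Require Import -(notations) mpoly.
From mathcomp Require Import ring lra.

Set Implicit Arguments.
Unset Strict Implicit.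
Unset Printing Implicit Defensive.

Import Order.TTheory GRing.Theory Num.Theory.
Import numFieldNormedType.Exports.

Local Open Scope classical_set_scope.
Local Open Scope ring_scope.

Local Notation normc := ComplexField.Normc.normc.

(** * Sums and products over the four points c + i^j s *)

Section FourPoints.
Variable R : realType.
Implicit Types (c w b : R[i]) (s : R).

Definition four_pts c s (j : 'I_4) : R[i] := c + 'i%C ^+ j * s%:C%C.

(** The points c + i^j s are the four roots in X of (X - c)^4 = s^4, and the number of factors is
    even, so no sign appears. *)
Lemma prod_four_pts_subr c s w :
  \prod_(j < 4) (four_pts c s j - w) = (c - w) ^+ 4 - (s ^+ 4)%:C%C.
Proof.
rewrite !big_ord_recl big_ord0 /four_pts /= /bump /= ?add1n ?addn0.
have i2 : 'i%C * 'i%C = -1 :> R[i] by rewrite -expr2 sqr_i.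
rewrite rmorphXn /=.
ring: i2.
Qed.

Lemma sqr_normc (t : R[i]) : normc t ^+ 2 = complex.Re t ^+ 2 + complex.Im t ^+ 2.
Proof.
by case: t => x y /=; rewrite sqr_sqrtr // addr_ge0 ?sqr_ge0.
Qed.

Lemma sum_four_pts_Re b c s :
  \sum_(j < 4) complex.Re (b * four_pts c s j) = complex.Re (b * c) *+ 4.
Proof.
rewrite !big_ord_recl big_ord0 /four_pts /= /bump /= ?add1n ?addn0.
case: b c => b1 b2 [c1 c2].
rewrite !exprS expr0 /=.
simpc => /=.
ring.
Qed.

(** The cross terms cancel because the fourth roots of unity sum to zero. The gain s^2 is what beats
    the error of order s^4 in [no_local_max]. *)
Lemma sum_four_pts_normc c s :
  \sum_(j < 4) normc (four_pts c s j) ^+ 2 = (normc c ^+ 2 + s ^+ 2) *+ 4.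
Proof.
under eq_bigr => j _ do rewrite sqr_normc.
rewrite !big_ord_recl big_ord0 /four_pts /= /bump /= ?add1n ?addn0 sqr_normc.
case: c => c1 c2.
rewrite !exprS !expr0 /=.
simpc => /=.
ring.
Qed.
End FourPoints.

(** * Four-point submean inequality for weighted products of polynomials *)

Section SubMeanValue.
Variable R : realType.
Implicit Types (c w b t : R[i]) (s : R) (q : {poly R[i]}).

Lemma normc_ge0 t : 0 <= normc t.
Proof. by case: t => x y /=; exact: sqrtr_ge0. Qed.

Lemma normc_eq0 t : (normc t == 0) = (t == 0).
Proof.
apply/eqP/eqP => [/ComplexField.Normc.eq0_normc//|->].
exact: ComplexField.Normc.normc0.
Qed.

Lemma normcX t n : normc (t ^+ n) = normc t ^+ n.
Proof.
elim: n => [|n IHn]; first by rewrite !expr0 ComplexField.Normc.normc1.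
by rewrite !exprS ComplexField.Normc.normcM IHn.
Qed.

Lemma normc_prod (I : Type) (r : seq I) (f : I -> R[i]) :
  normc (\prod_(i <- r) f i) = \prod_(i <- r) normc (f i).
Proof.
apply: (big_morph (@ComplexField.Normc.normc R)).
  exact: ComplexField.Normc.normcM.
exact: ComplexField.Normc.normc1.
Qed.

Lemma normc_real s : normc (s%:C)%C = `|s|.
Proof. by rewrite /= expr0n /= addr0 sqrtr_sqr. Qed.

Lemma normc_four_pts_le c s j : 0 <= s -> normc (four_pts c s j) <= normc c + s.
Proof.
move=> s0; apply: le_trans (le_normcD _ _) _.
rewrite lerD2l ComplexField.Normc.normcM normcX normc_real ger0_norm//.
by rewrite /= expr0n /= add0r expr1n sqrtr1 expr1n mul1r.
Qed.

(** A multiplicative form of the submean inequality for log |q|, with error C s^4. It is stable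
    under products and nonnegative real powers, and it stays meaningful at the zeros of q. *)
Definition four_pts_bound c q (C e : R) := forall s, 0 <= s <= e ->
  normc q.[c] ^+ 4 * expR (- (C * s ^+ 4)) <=
  \prod_(j < 4) normc q.[four_pts c s j].

(* |1 - x| >= exp (- 2 x) for 0 <= x <= 1/2, with x = (s / |c - w|) ^ 4 *)
Lemma four_pts_bound_XsubC c w :
  exists C, exists2 e, 0 < e & four_pts_bound c ('X - w%:P) C e.
Proof.
have [->|cw] := eqVneq c w.
  exists 0; exists 1 => // s _.
  rewrite hornerXsubC subrr ComplexField.Normc.normc0 expr0n /= mul0r.
  by apply: prodr_ge0 => j _; exact: normc_ge0.
have l0 : 0 < normc (c - w).
  by rewrite lt_def normc_ge0 normc_eq0 subr_eq0 cw.
set l := normc (c - w) in l0 *.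
exists (2 / l ^+ 4); exists (l / 2); first by rewrite divr_gt0.
move=> s /andP[s0 sl].
under eq_bigr do rewrite hornerXsubC.
rewrite -normc_prod prod_four_pts_subr hornerXsubC -/l.
have sl4 : s ^+ 4 / l ^+ 4 <= 2^-1.
  rewrite -expr_div_n; apply: (@le_trans _ _ (2^-1 ^+ 4)).
    rewrite lerXn2r ?nnegrE ?divr_ge0 ?(ltW l0)//.
    by rewrite ler_pdivrMr// mulrC.
  by rewrite !exprS expr0; lra.
have : l ^+ 4 - s ^+ 4 <= normc ((c - w) ^+ 4 - (s ^+ 4)%:C%C).
  have s4 : normc (s ^+ 4)%:C%C = s ^+ 4 by rewrite normc_real ger0_norm ?exprn_ge0.
  rewrite -[X in _ - X <= _]s4 lerBlDr -normcX.
  by apply: le_trans (le_normcD _ _); rewrite subrK.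
apply: le_trans.
have l40 : 0 < l ^+ 4 by rewrite exprn_gt0.
set x := s ^+ 4 / l ^+ 4 in sl4.
have -> : s ^+ 4 = l ^+ 4 * x by rewrite mulrC divfK ?gt_eqF.
have x0 : 0 <= x by rewrite divr_ge0 ?exprn_ge0// ltW.
have -> : 2 / l ^+ 4 * (l ^+ 4 * x) = 2 * x by rewrite mulrA divfK ?gt_eqF.
(* This follows from exp (2 x) >= 1 + 2 x and, for 0 <= x <= 1/2, (1 - x) (1 + 2 x) >= 1. *)
rewrite -[X in X - _]mulr1 -mulrBr ler_pM2l// expRN.
rewrite -[leRHS]invrK lef_pV2 ?posrE ?expR_gt0 ?invr_gt0 ?expR_gt0//; last by lra.
apply: le_trans (expR_ge1Dx _).
rewrite -[leLHS]mul1r ler_pdivrMr; last by lra.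
by nra.
Qed.

(** Over the complex numbers q splits into linear factors; multiplying two bounds adds the constants
    and keeps the smaller radius. *)
Lemma four_pts_bound_poly c q :
  exists C, exists2 e, 0 < e & four_pts_bound c q C e.
Proof.
have [rs ->] := closed_field_poly_normal q.
elim: rs (lead_coef q) => [|w rs IH] l.
  exists 0; exists 1 => // s _.
  rewrite big_nil hornerZ hornerC mulr1 mul0r oppr0 expR0 mulr1.
  under eq_bigr do rewrite hornerZ hornerC mulr1.
  by rewrite prodr_const card_ord.
have [C1 [e1 e10 H1]] := four_pts_bound_XsubC c w.
have [C2 [e2 e20 H2]] := IH l.
exists (C1 + C2); exists (Num.min e1 e2); first by rewrite lt_min e10.
move=> s /andP[s0]; rewrite le_min => /andP[s1 s2].
rewrite big_cons scalerAr; set g := _ *: _ in H2 *.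
rewrite hornerM ComplexField.Normc.normcM.
under eq_bigr do rewrite hornerM ComplexField.Normc.normcM.
rewrite big_split /= exprMn mulrDl opprD expRD mulrACA.
by apply: ler_pM; rewrite ?mulr_ge0 ?exprn_ge0 ?normc_ge0 ?expR_ge0//;
  [apply: H1|apply: H2]; rewrite s0.
Qed.

Definition wprod N (a : 'I_N -> R) (u : 'I_N -> R[i]) : R :=
  \prod_(k < N) normc (u k) `^ a k.

Lemma wprod_ge0 N (a : 'I_N -> R) u : 0 <= wprod a u.
Proof. by apply: prodr_ge0 => k _; exact: powR_ge0. Qed.

Lemma powR_prod (I : Type) (r : seq I) (f : I -> R) x :
  (forall i, 0 <= f i) -> (\prod_(i <- r) f i) `^ x = \prod_(i <- r) f i `^ x.
Proof.
move=> f0; elim: r => [|i r IH]; first by rewrite !big_nil powR1.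
by rewrite !big_cons powRM ?IH// prodr_ge0.
Qed.

(** Raising the bound for q_k to the power a_k >= 0 preserves it and multiplies its constant by
    a_k. *)
Lemma four_pts_bound_wprod N (a : 'I_N -> R) (q : 'I_N -> {poly R[i]}) c :
  (forall k, 0 <= a k) ->
  exists C, exists2 e, 0 < e & forall s, 0 <= s <= e ->
    wprod a (fun k => (q k).[c]) ^+ 4 * expR (- (C * s ^+ 4)) <=
    \prod_(j < 4) wprod a (fun k => (q k).[four_pts c s j]).
Proof.
move=> a0; rewrite /wprod.
elim: N a q a0 => [|N IH] a q a0.
  exists 0; exists 1 => // s _.
  under [leRHS]eq_bigr do rewrite big_ord0.
  by rewrite big_ord0 big1// mul0r oppr0 expR0 expr1n mulr1.
have [C1 [e1 e10 H1]] := four_pts_bound_poly c (q ord0).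
have [C2 [e2 e20 H2]] := IH (fun k => a (lift ord0 k))
  (fun k => q (lift ord0 k)) (fun k => a0 _).
exists (a ord0 * C1 + C2); exists (Num.min e1 e2); first by rewrite lt_min e10.
move=> s /andP[s0]; rewrite le_min => /andP[s1 s2].
under [leRHS]eq_bigr do rewrite big_ord_recl.
rewrite big_ord_recl big_split /= exprMn mulrDl opprD expRD mulrACA.
apply: ler_pM; last by apply: H2; rewrite s0.
- by rewrite mulr_ge0 ?exprn_ge0 ?expR_ge0 ?powR_ge0.
- by rewrite mulr_ge0 ?expR_ge0 ?exprn_ge0 ?prodr_ge0// => k _; exact: powR_ge0.
rewrite -powR_prod => [|j]; last exact: normc_ge0.
set n0 := normc (q ord0).[c].
have -> : (n0 `^ a ord0) ^+ 4 * expR (- (a ord0 * C1 * s ^+ 4)) =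
    (n0 ^+ 4 * expR (- (C1 * s ^+ 4))) `^ a ord0.
  rewrite powRM ?exprn_ge0 ?normc_ge0 ?expR_ge0// -expRM.
  rewrite -!powR_mulrn ?powR_ge0 ?normc_ge0// powRAC; congr (_ * expR _).
  by ring.
apply: ge0_ler_powR; rewrite ?nnegrE ?mulr_ge0 ?exprn_ge0 ?normc_ge0 ?expR_ge0//.
  by apply: prodr_ge0 => j _; exact: normc_ge0.
by apply: H1; rewrite s0.
Qed.
End SubMeanValue.

(** * Continuity of moduli, weighted products and norms *)

Section Continuity.
Variables (R : realType) (T : topologicalType).
Implicit Types f g : T -> R[i].

(** Stated on real and imaginary parts, so that the only topology on the target is that of [R]. *)
Definition ccontinuous f :=
  continuous (fun x => complex.Re (f x)) /\ continuous (fun x => complex.Im (f x)).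

Lemma ccontinuous_cst (c : R[i]) : ccontinuous (fun=> c).
Proof. by split => x; exact: cvg_cst. Qed.

Lemma ccontinuousD f g :
  ccontinuous f -> ccontinuous g -> ccontinuous (fun x => f x + g x).
Proof.
move=> [f1 f2] [g1 g2]; split.
- have -> : (fun x => complex.Re (f x + g x)) =
    (fun x => complex.Re (f x) + complex.Re (g x)).
    by apply/funext => x; case: (f x) (g x) => ? ? [].
  by move=> x; apply: cvgD; [exact: f1|exact: g1].
- have -> : (fun x => complex.Im (f x + g x)) =
    (fun x => complex.Im (f x) + complex.Im (g x)).
    by apply/funext => x; case: (f x) (g x) => ? ? [].
  by move=> x; apply: cvgD; [exact: f2|exact: g2].
Qed.

Lemma ccontinuousM f g :
  ccontinuous f -> ccontinuous g -> ccontinuous (fun x => f x * g x).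
Proof.
move=> [f1 f2] [g1 g2]; split.
- have -> : (fun x => complex.Re (f x * g x)) = (fun x =>
    complex.Re (f x) * complex.Re (g x) - complex.Im (f x) * complex.Im (g x)).
    by apply/funext => x; case: (f x) (g x) => ? ? [].
  by move=> x; apply: cvgB; apply: cvgM;
    [exact: f1|exact: g1|exact: f2|exact: g2].
- have -> : (fun x => complex.Im (f x * g x)) = (fun x =>
    complex.Re (f x) * complex.Im (g x) + complex.Im (f x) * complex.Re (g x)).
    by apply/funext => x; case: (f x) (g x) => ? ? [].
  by move=> x; apply: cvgD; apply: cvgM;
    [exact: f1|exact: g2|exact: f2|exact: g1].
Qed.

Lemma ccontinuous_prod (I : Type) (r : seq I) (F : I -> T -> R[i]) :
  (forall i, ccontinuous (F i)) -> ccontinuous (fun x => \prod_(i <- r) F i x).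
Proof.
move=> cF; elim: r => [|i r IH].
  by under eq_fun do rewrite big_nil; exact: ccontinuous_cst.
by under eq_fun do rewrite big_cons; exact: ccontinuousM.
Qed.

Lemma ccontinuousX f n : ccontinuous f -> ccontinuous (fun x => f x ^+ n).
Proof.
move=> cf; elim: n => [|n IH].
  by under eq_fun do rewrite expr0; exact: ccontinuous_cst.
by under eq_fun do rewrite exprS; exact: ccontinuousM.
Qed.

Lemma ccontinuous_horner (q : {poly R[i]}) f :
  ccontinuous f -> ccontinuous (fun x => q.[f x]).
Proof.
move=> cf; elim/poly_ind: q => [|q c IH].
  by under eq_fun do rewrite horner0; exact: ccontinuous_cst.
under eq_fun do rewrite hornerMXaddC.
by apply: ccontinuousD (ccontinuous_cst _); exact: ccontinuousM.
Qed.

Lemma ccontinuous_meval d (p : mpoly d R[i]) (v : T -> 'I_d -> R[i]) :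
  (forall i, ccontinuous (fun x => v x i)) ->
  ccontinuous (fun x => meval (v x) p).
Proof.
move=> cv; elim/mpolyind: p => [|c m p _ _ IH].
  by under eq_fun do rewrite meval0; exact: ccontinuous_cst.
under eq_fun do rewrite mevalD mevalZ mevalX.
apply: ccontinuousD => //; apply: ccontinuousM; first exact: ccontinuous_cst.
by apply: ccontinuous_prod => i; exact: ccontinuousX.
Qed.

Lemma continuous_normc f :
  ccontinuous f -> continuous (fun x => normc (f x)).
Proof.
move=> [f1 f2].
have -> : (fun x => normc (f x)) =
    (fun x => Num.sqrt (complex.Re (f x) ^+ 2 + complex.Im (f x) ^+ 2)).
  by apply/funext => x; case: (f x).
move=> x; apply: continuous_comp; last exact: sqrt_continuous.
by apply: cvgD; apply: cvgM; solve [exact: f1|exact: f2].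
Qed.

(** At 0 the radius e^(1/a) works; elsewhere the power is locally exp (a ln |u|). The absolute value
    gives continuity on the whole line and changes nothing on moduli. *)
Lemma continuous_normr_powR (a : R) : 0 < a -> continuous (fun u : R => `|u| `^ a).
Proof.
move=> a0 u; have [->|u0] := eqVneq u 0.
  apply/cvgrPdist_lt => e e0; apply/nbhs_ballP.
  exists (e `^ a^-1); first by rewrite /= powR_gt0.
  move=> v; rewrite /ball /= sub0r normrN => ve.
  rewrite normr0 powR0 ?gt_eqF// sub0r normrN ger0_norm ?powR_ge0//.
  rewrite -[ltRHS](@powRr1 _ e) ?ltW// -(@mulVf _ a) ?gt_eqF// powRrM.
  by rewrite gt0_ltr_powR ?nnegrE ?normr_ge0 ?powR_ge0.
rewrite /continuous_at.
apply: (@cvg_trans _ ((fun v : R => expR (a * ln `|v|)) @ u)).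
  apply: near_eq_cvg; near=> v.
  rewrite /powR normr_eq0 ifF//; apply/negbTE.
  near: v.
  exists `|u|; first by rewrite /= normr_gt0.
  move=> v /=; apply: contraTneq => ->; by rewrite subr0 ltxx.
rewrite /powR normr_eq0 (negbTE u0).
apply: (@continuous_comp _ _ _ (fun v : R => a * ln `|v|) expR u);
  last exact: continuous_expR.
apply: cvgM; first exact: cvg_cst.
apply: (@continuous_comp _ _ _ (fun v : R => `|v|) (@ln R) u).
  exact: norm_continuous.
by apply: continuous_ln; rewrite normr_gt0.
Unshelve. all: by end_near.
Qed.

Lemma continuous_wprod N (a : 'I_N -> R) (u : T -> 'I_N -> R[i]) :
  (forall k, 0 < a k) -> (forall k, ccontinuous (fun x => u x k)) ->
  continuous (fun x => wprod a (u x)).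
Proof.
rewrite /wprod => a0 cu; elim: N a u a0 cu => [|N IH] a u a0 cu.
  by under eq_fun do rewrite big_ord0; move=> x; exact: cvg_cst.
under eq_fun do rewrite big_ord_recl.
move=> x; apply: cvgM; last exact: (IH _ (fun x k => u x (lift ord0 k))).
under eq_fun do rewrite -[normc _]ger0_norm ?normc_ge0//.
rewrite -[normc _]ger0_norm ?normc_ge0//.
apply: (@continuous_comp _ _ _ (fun x => normc (u x ord0)) (fun u => `|u| `^ a ord0)).
  exact: continuous_normc.
exact: continuous_normr_powR.
Qed.

Lemma continuous_addr (g h : T -> R) :
  continuous g -> continuous h -> continuous (fun x => g x + h x).
Proof. by move=> cg ch x; apply: cvgD; [exact: cg|exact: ch]. Qed.

Lemma continuous_mulr (g h : T -> R) :
  continuous g -> continuous h -> continuous (fun x => g x * h x).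
Proof. by move=> cg ch x; apply: cvgM; [exact: cg|exact: ch]. Qed.

Lemma continuous_expR_comp (g : T -> R) :
  continuous g -> continuous (fun x => expR (g x)).
Proof.
by move=> cg x; apply: continuous_comp; [exact: cg|exact: continuous_expR].
Qed.

Lemma continuous_sum_ord d (g : 'I_d -> T -> R) :
  (forall i, continuous (g i)) -> continuous (fun x => \sum_(i < d) g i x).
Proof.
move=> cg; elim: d g cg => [|d IH] g cg.
  by under eq_fun do rewrite big_ord0; move=> x; exact: cvg_cst.
under eq_fun do rewrite big_ord_recl.
by move=> x; apply: cvgD; [exact: cg|exact: IH].
Qed.

Lemma continuous_eucl_norm d (v : T -> 'rV[R[i]]_d) :
  (forall i, ccontinuous (fun x => v x 0 i)) ->
  continuous (fun x => eucl_norm (v x)).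
Proof.
move=> cv x; apply: continuous_comp; last exact: sqrt_continuous.
apply: continuous_sum_ord => i y.
by apply: cvgM; exact: continuous_normc.
Qed.

End Continuity.

Lemma normr_Re_le_normc (R : realType) (t : R[i]) : `|complex.Re t| <= normc t.
Proof.
by case: t => x y /=; rewrite -sqrtr_sqr ler_wsqrtr// lerDl sqr_ge0.
Qed.

Lemma normr_Im_le_normc (R : realType) (t : R[i]) : `|complex.Im t| <= normc t.
Proof.
by case: t => x y /=; rewrite -sqrtr_sqr ler_wsqrtr// lerDr sqr_ge0.
Qed.

(** * Maxima on closed balls of C^d *)

Section BallMaximum.
Variables (R : realType) (d : nat).

(** Identifies R^(2d) with C^d, so that the extreme value theorem for real row vectors applies. *)
Definition complex_row (x : 'rV[R]_(d + d)) : 'rV[R[i]]_d :=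
  \row_i (x 0 (lshift d i) +i* x 0 (rshift d i))%C.

Lemma ccontinuous_complex_row i : ccontinuous (fun x => complex_row x 0 i).
Proof.
by split; under eq_fun do rewrite mxE /=; exact: coord_continuous.
Qed.

Lemma eucl_norm_ge0 (z : 'rV[R[i]]_d) : 0 <= eucl_norm z.
Proof. exact: sqrtr_ge0. Qed.

Lemma sqr_eucl_norm (z : 'rV[R[i]]_d) :
  eucl_norm z ^+ 2 = \sum_(i < d) normc (z 0 i) ^+ 2.
Proof. by rewrite sqr_sqrtr// sumr_ge0// => i _; exact: sqr_ge0. Qed.

Lemma normc_le_eucl_norm (z : 'rV[R[i]]_d) i : normc (z 0 i) <= eucl_norm z.
Proof.
rewrite -(@ler_pXn2r _ 2) ?nnegrE ?normc_ge0 ?eucl_norm_ge0// sqr_eucl_norm.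
by rewrite (bigD1 i)//= lerDl sumr_ge0// => j _; exact: sqr_ge0.
Qed.

Lemma eucl_norm0 : eucl_norm (0 : 'rV[R[i]]_d) = 0.
Proof.
rewrite /eucl_norm big1 ?sqrtr0// => i _.
by rewrite mxE ComplexField.Normc.normc0 expr0n.
Qed.

(** Pulled back to R^(2d), the ball is closed, and bounded since each real coordinate is at most the
    Euclidean norm; hence it is compact. *)
Lemma ball_argmax (f : 'rV[R[i]]_d -> R) (r : R) : 0 <= r ->
  continuous (fun x => f (complex_row x)) ->
  exists2 z, eucl_norm z <= r & forall y, eucl_norm y <= r -> f y <= f z.
Proof.
move=> r0 cf.
pose A : set 'rV[R]_(d + d) := [set x | eucl_norm (complex_row x) <= r].
have complex_row_surj z : exists x, complex_row x = z.
  exists (row_mx (\row_i complex.Re (z 0 i)) (\row_i complex.Im (z 0 i))).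
  apply/rowP => i; rewrite !mxE/= (unsplitK (inl _ i)) (unsplitK (inr _ i)) !mxE.
  by case: (z 0 i).
have A0 : A !=set0.
  by have [x x0] := complex_row_surj 0; exists x; rewrite /A /= x0 eucl_norm0.
have cA : compact A.
  apply: bounded_closed_compact; last first.
    have -> : A = (fun x => eucl_norm (complex_row x)) @^-1` [set y | y <= r] by [].
    apply: preimage_closed; last exact: closed_le.
    by apply: in1W; exact: continuous_eucl_norm ccontinuous_complex_row.
  exists r; split; first exact: num_real.
  move=> M rM x Ax.
  have M0 : 0 <= M by rewrite (le_trans r0)// ltW.
  rewrite /= /Num.Def.normr /= mx_normrE; apply/bigmax_leP; split=> // -[i j] _ /=.
  rewrite ord1; apply: le_trans (ltW rM); apply: le_trans _ Ax.
  case: (split_ordP j) => k ->;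
    apply: le_trans (normc_le_eucl_norm _ k); rewrite mxE.
    exact: (normr_Re_le_normc (_ +i* _)%C).
  exact: (normr_Im_le_normc (_ +i* _)%C).
have [c Ac cmax] := EVT_max_rV A0 cA (continuous_subspaceT cf).
exists (complex_row c); first by move: Ac; rewrite inE.
move=> y yr; have [x xy] := complex_row_surj y.
by rewrite -xy; apply: cmax; rewrite inE /A /= xy.
Qed.

End BallMaximum.

(** * Maximum principle on discs *)

Section DiscMaximum.
Variable R : realType.
Variables (N : nat) (a : 'I_N -> R) (q : 'I_N -> {poly R[i]}) (b : R[i]).
Hypothesis a_gt0 : forall k, 0 < a k.

(** exp (Re (b t)) is the modulus of the entire function exp (b t). For e > 0 the term e |t|^2 makes
    log psi strictly subharmonic off its zeros. *)
Let psi (e : R) (t : R[i]) : R := wprod a (fun k => (q k).[t]) *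
  expR (complex.Re (b * t) + e * normc t ^+ 2).

Let psi_ge0 e t : 0 <= psi e t.
Proof. by rewrite mulr_ge0 ?wprod_ge0 ?expR_ge0. Qed.

(* The product over [four_pts c s] is at least
   [psi e c ^+ 4 * expR (4 e s^2 - C s^4)] for small [s]. *)
Lemma no_local_max e c (eta : R) : 0 < e -> 0 < eta -> psi e c != 0 ->
  exists2 s, 0 <= s <= eta & exists j, psi e c < psi e (four_pts c s j).
Proof.
move=> e0 eta0 c0.
have [C [eta1 eta10 H]] := four_pts_bound_wprod q c (fun k => ltW (a_gt0 k)).
(* From s <= 1 and (|C| + 1) s <= e follows C s^4 <= e s^2 < 4 e s^2. *)
pose s := Num.min 1 (Num.min eta (Num.min eta1 (e / (`|C| + 1)))).
have C1 : 0 < `|C| + 1 by rewrite ltr_wpDl.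
have s0 : 0 < s by rewrite !lt_min ltr01 eta0 eta10 divr_gt0.
have [s1 [s2 [s3 s4]]] : s <= 1 /\ s <= eta /\ s <= eta1 /\ s <= e / (`|C| + 1).
  by rewrite /s !ge_min !lexx !orbT.
exists s; first by rewrite ltW.
apply: contrapT => small.
have Cs : C * s ^+ 4 < 4 * e * s ^+ 2.
  have Cs1 : `|C| * s <= e.
    rewrite (le_trans (y := (`|C| + 1) * s))//.
      by apply: ler_wpM2r; [exact: ltW|rewrite lerDl].
    by rewrite mulrC -ler_pdivlMr.
  have s20 : 0 < s ^+ 2 by rewrite exprn_gt0.
  rewrite (exprD s 2 2) mulrA ltr_pM2r//.
  rewrite (le_lt_trans (y := e))//; last by lra.
  rewrite expr2 mulrA; apply: le_trans Cs1.
  apply: (@le_trans _ _ (`|C| * s * s)).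
    by rewrite !(ler_wpM2r (ltW s0))// ler_norm.
  by rewrite ler_piMr// mulr_ge0// ltW.
have ltpsi : psi e c ^+ 4 <
    \prod_(j < 4) psi e (four_pts c s j).
  rewrite /psi big_split /= -expR_sum big_split /= -mulr_sumr.
  rewrite sum_four_pts_Re sum_four_pts_normc.
  have := H s; rewrite (ltW s0) s3 => /(_ isT).
  set X := wprod _ _; set Y := \prod_(j < 4) _ => XY.
  have X0 : 0 < X ^+ 4.
    rewrite exprn_gt0// lt_def wprod_ge0 andbT.
    by apply: contraNneq c0 => X0; rewrite /psi -/X X0 mul0r.
  rewrite exprMn.
  apply: (lt_le_trans _ (ler_wpM2r (expR_ge0 _) XY)).
  rewrite -(mulrA (X ^+ 4)) -expRD ltr_pM2l// -expRM_natl ltr_expR.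
  by lra.
have : \prod_(j < 4) psi e (four_pts c s j) <= psi e c ^+ 4.
  rewrite -[4%N in leRHS]card_ord -prodr_const; apply: ler_prod => j _.
  by rewrite psi_ge0 leNgt; apply/negP => jlt; apply: small; exists j.
by rewrite leNgt ltpsi.
Qed.

(** A maximum over the closed disc lies on the circle, or has value 0 <= M, or is interior and
    nonzero, which [no_local_max] excludes. *)
Lemma disc_max_perturbed e (rho M : R) : 0 < e -> 0 < rho -> 0 <= M ->
  (forall t, normc t = rho -> psi e t <= M) ->
  forall t, normc t <= rho -> psi e t <= M.
Proof.
move=> e0 rho0 M0 HM t trho.
have norm1 (z : 'rV[R[i]]_1) : eucl_norm z = normc (z 0 0).
  by rewrite /eucl_norm big_ord1 sqrtr_sqr ger0_norm ?normc_ge0.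
have [|z zr zmax] := @ball_argmax R 1 (fun z => psi e (z 0 0)) rho (ltW rho0).
  have c0 := @ccontinuous_complex_row R 1 0.
  have cw : continuous (fun x : 'rV[R]_(1 + 1) =>
      wprod a (fun k => (q k).[complex_row x 0 0])).
    apply: (@continuous_wprod R _ N a (fun x k => (q k).[complex_row x 0 0])) => // k.
    exact: ccontinuous_horner c0.
  have cg : continuous (fun x : 'rV[R]_(1 + 1) =>
      complex.Re (b * complex_row x 0 0) + e * normc (complex_row x 0 0) ^+ 2).
    have [cb _] := ccontinuousM (@ccontinuous_cst R 'rV[R]_(1 + 1) b) c0.
    have cn := continuous_normc c0.
    apply: continuous_addr cb _.
    by apply: continuous_mulr; [exact: cst_continuous|exact: (continuous_mulr cn cn)].
  exact: continuous_mulr cw (continuous_expR_comp cg).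
have tz : psi e t <= psi e (z 0 0).
  have := zmax (const_mx t); rewrite norm1 !mxE; exact.
apply: le_trans tz _; rewrite norm1 in zr.
move: zr; rewrite le_eqVlt => /predU1P[/HM//|zr].
have [->//|z0] := eqVneq (psi e (z 0 0)) 0.
(* Taking for eta the distance to the circle keeps the four points in the disc. *)
have [|s /andP[s0 s1] [j]] := no_local_max e0 (eta := rho - normc (z 0 0)) _ z0.
  by rewrite subr_gt0.
rewrite ltNge => /negP[].
have := zmax (const_mx (four_pts (z 0 0) s j)); rewrite norm1 !mxE; apply.
apply: le_trans (normc_four_pts_le _ _ s0) _.
by rewrite -lerBrDl.
Qed.

(** The perturbed principle with bound M exp (e rho^2), as e tends to 0. *)
Lemma disc_max (rho M : R) : 0 < rho -> 0 <= M ->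
  (forall t, normc t = rho ->
     wprod a (fun k => (q k).[t]) * expR (complex.Re (b * t)) <= M) ->
  forall t, normc t <= rho ->
    wprod a (fun k => (q k).[t]) * expR (complex.Re (b * t)) <= M.
Proof.
move=> rho0 M0 HM t trho.
set L := wprod _ _ * _.
have L0 : 0 <= L by rewrite mulr_ge0 ?wprod_ge0 ?expR_ge0.
have key e : 0 < e -> L <= M * expR (e * rho ^+ 2).
  move=> e0; apply: (@le_trans _ _ (psi e t)).
    rewrite /psi expRD mulrA ler_peMr// -expR0 ler_expR.
    by rewrite mulr_ge0 ?exprn_ge0 ?normc_ge0// ltW.
  apply: disc_max_perturbed rho0 _ _ _ trho => //.
    by rewrite mulr_ge0 ?expR_ge0.
  move=> u urho; rewrite /psi expRD mulrA urho ler_wpM2r ?expR_ge0//.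
  exact: HM.
rewrite leNgt; apply/negP => ML.
have [MM|MM] := eqVneq M 0.
  by have := key 1 ltr01; rewrite MM mul0r leNgt -MM ML.
have MM0 : 0 < M by rewrite lt_def MM.
have LM : 0 < ln (L / M) by rewrite ln_gt0// ltr_pdivlMr// mul1r.
have LME : L / M = expR (ln (L / M)).
  by rewrite lnK// posrE divr_gt0// (le_lt_trans M0).
have r2 : 0 < rho ^+ 2 by rewrite exprn_gt0.
(* This e turns [key] into ln (L / M) <= ln (L / M) / 2, against L > M. *)
have := key (ln (L / M) / 2 / rho ^+ 2).
rewrite !divr_gt0// => /(_ isT).
rewrite divfK ?gt_eqF// mulrC -ler_pdivrMr// {1}LME ler_expR.
by lra.
Qed.

End DiscMaximum.

(** * Restriction to complex lines, and nonzero values near the origin *)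

Section Line.
Variables (R : realType) (d : nat).
Implicit Types (x v z : 'rV[R[i]]_d) (p : mpoly d R[i]) (q : {poly R[i]}).

Definition line_poly x v p : {poly R[i]} :=
  \sum_(m <- msupp p)
    mcoeff m p *: \prod_(i < d) ((x 0 i)%:P + v 0 i *: 'X) ^+ m i.

Lemma horner_line_poly x v p t :
  (line_poly x v p).[t] = meval ((x + t *: v) 0) p.
Proof.
rewrite mevalE horner_sum; apply: eq_bigr => m _.
rewrite hornerZ horner_prod; congr (_ * _); apply: eq_bigr => i _.
by rewrite horner_exp hornerD hornerC hornerZ hornerX !mxE mulrC.
Qed.

Lemma size_line_poly x v p : (size (line_poly x v p) <= msize p)%N.
Proof.
apply: (leq_trans (size_sum _ _ _)); apply/bigmax_leqP_seq => m mp _.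
apply: leq_trans (size_scale_leq _ _) _.
apply: leq_trans (msize_mdeg_lt mp).
rewrite mdegE; elim/big_ind2: _ => [|q1 n1 q2 n2 H1 H2|i _].
- by rewrite size_poly1.
- apply: leq_trans (size_polyMleq _ _) _.
  rewrite -subn1 leq_subLR add1n -addSn -addnS; exact: leq_add.
apply: leq_trans (size_exp_leq _ _) _.
rewrite ltnS -[leqRHS]mul1n leq_mul2r -subn1 leq_subLR addn1 orbC.
apply/orP; left; apply: leq_trans (size_polyD _ _) _; rewrite geq_max.
rewrite (leq_trans (size_polyC_leq1 _))//=.
by rewrite (leq_trans (size_scale_leq _ _))// size_polyX.
Qed.

(** When n bounds the degree of q this is s^n q(1/s), which moves infinity to the origin. *)
Definition reverse_poly n q : {poly R[i]} := \poly_(i < n.+1) q`_(n - i).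

Lemma horner_reverse_poly n q s : (size q <= n.+1)%N -> s != 0 ->
  (reverse_poly n q).[s] = s ^+ n * q.[s^-1].
Proof.
move=> qn s0; rewrite horner_poly (horner_coef_wide _ qn) mulr_sumr.
rewrite [LHS](reindex_inj rev_ord_inj) /=; apply: eq_bigr => i _.
have iN : (i <= n)%N by rewrite -ltnS.
rewrite subSS subKn// mulrCA; congr (_ * _).
by rewrite exprVn expfB_cond// (negbTE s0).
Qed.

Lemma eucl_normZ (t : R[i]) z : eucl_norm (t *: z) = normc t * eucl_norm z.
Proof.
rewrite /eucl_norm -[normc t]ger0_norm ?normc_ge0// -sqrtr_sqr -sqrtrM ?sqr_ge0//.
congr Num.sqrt; rewrite mulr_sumr; apply: eq_bigr => i _.
by rewrite mxE ComplexField.Normc.normcM exprMn.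
Qed.

(** The middle term is harmonic in t and the last depends on |t| only: on a circle centered at 0 the
    gaussian is a constant times the modulus of some exp (b t). *)
Lemma sqr_eucl_normD x v (t : R[i]) : eucl_norm (x + t *: v) ^+ 2 =
  eucl_norm x ^+ 2 + complex.Re ((\sum_(i < d) v 0 i * (x 0 i)^*%C) * t) *+ 2 +
  normc t ^+ 2 * eucl_norm v ^+ 2.
Proof.
rewrite !sqr_eucl_norm mulr_suml raddf_sum/= -sumrMnl mulr_sumr -!big_split/=.
apply: eq_bigr => i _; rewrite !mxE !sqr_normc.
case: (x 0 i) (v 0 i) t => x1 x2 [v1 v2] [t1 t2].
simpc => /=.
by ring.
Qed.

(** Uniqueness of base D expansions: compare remainders modulo D, then quotients. *)
Lemma sum_digits_inj D (f g : nat -> nat) n :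
  (forall i, (i < n)%N -> (f i < D)%N) -> (forall i, (i < n)%N -> (g i < D)%N) ->
  (\sum_(i < n) f i * D ^ i = \sum_(i < n) g i * D ^ i)%N ->
  forall i, (i < n)%N -> f i = g i.
Proof.
elim: n f g => [//|n IH] f g fD gD.
rewrite !big_ord_recl !expn0 !muln1 /=.
have shift (h : nat -> nat) : (\sum_(i < n) h (bump 0 i) * D ^ bump 0 i =
    (\sum_(i < n) h i.+1 * D ^ i) * D)%N.
  rewrite big_distrl; apply: eq_bigr => i _.
  by rewrite /bump /= add1n expnS -mulnA [(D * _)%N]mulnC.
rewrite !shift addnC [X in _ = X]addnC => e.
have D0 : (0 < D)%N by exact: leq_ltn_trans (fD 0%N _).
have e0 : f 0%N = g 0%N.
  have := congr1 (modn^~ D) e; rewrite /= !modnMDl.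
  by rewrite !modn_small ?fD ?gD.
have e1 := congr1 (divn^~ D) e.
rewrite /= !divnMDl// !divn_small ?fD ?gD// !addn0 in e1.
case=> [//|i]; rewrite ltnS; apply: (IH (f \o succn) (g \o succn)) => // j jn.
  exact: fD.
exact: gD.
Qed.

(* Kronecker's substitution X_i := s ^ (D ^ i) separates the monomials of [p]. *)
Lemma meval_neq0_near0 p (e : R) : p != 0 -> 0 < e ->
  exists2 z : 'rV[R[i]]_d, eucl_norm z <= e & meval (z 0) p != 0.
Proof.
(* [msize p] exceeds every exponent occurring in [p], so the exponents of a monomial are the base D
   digits of its image under [E]. *)
move=> p0 e0; pose D := msize p.
have D0 : (0 < D)%N by rewrite lt0n msize_poly_eq0.
pose E (m : multinom d) := (\sum_(i < d) m i * D ^ i)%N.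
have E_inj : {in msupp p &, injective E}.
  move=> m1 m2 m1p m2p e12; apply/mnmP => i.
  pose f (m : multinom d) j := if insub j is Some i then m i else 0%N.
  have fE m (k : 'I_d) : f m k = m k by rewrite /f valK.
  have fD m j : m \in msupp p -> (j < d)%N -> (f m j < D)%N.
    move=> mp jd; rewrite (fE m (Ordinal jd)).
    apply: leq_trans (msize_mdeg_lt mp).
    by rewrite ltnS mdegE (bigD1 (Ordinal jd))//= leq_addr.
  rewrite -!fE; apply: (@sum_digits_inj D _ _ d) (ltn_ord i).
  - by move=> j; exact: fD.
  - by move=> j; exact: fD.
  - under eq_bigr do rewrite fE.
    by under [RHS]eq_bigr do rewrite fE.
pose h : {poly R[i]} := \sum_(m <- msupp p) mcoeff m p *: 'X^(E m).
have h0 : h != 0.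
  have [m mp] : exists m, m \in msupp p.
    case: (msupp p) (msupp_eq0 p) => [|m s _]; first by rewrite (negbTE p0) eqxx.
    by exists m; rewrite inE eqxx.
  apply/negP => /eqP/(congr1 (fun q : {poly R[i]} => q`_(E m))).
  rewrite coef0 coef_sum (bigD1_seq m) ?msupp_uniq//= coefZ coefXn eqxx mulr1.
  rewrite big_seq_cond big1 ?addr0 => [/eqP|m' /andP[m'p m'm]].
    by rewrite mcoeff_eq0 mp.
  rewrite coefZ coefXn; case: eqP => [/E_inj mm|]; last by rewrite mulr0.
  by rewrite mm ?eqxx in m'm.
(* The bound 1 gives s^(D^i) <= s for 0 < s <= s0, so the norm is at most sqrt d * s <= (d + 1) s <=
   e. *)
pose s0 : R := Num.min 1 (e / d.+1%:R).
have s00 : 0 < s0 by rewrite lt_min ltr01 divr_gt0.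
pose s j : R := s0 / j.+1%:R.
(* The points [s j] are pairwise distinct, and [h] has fewer than [size h] roots. *)
have [j hj] : exists j, ~~ root h (s j)%:C%C.
  apply: contrapT => allroot.
  have : (size (map (fun j => (s j)%:C%C) (iota 0 (size h))) < size h)%N.
    apply: max_poly_roots => //.
      apply/allP => _ /mapP[j _ ->]; apply: contrapT => /negP hj.
      by apply: allroot; exists j.
    rewrite map_inj_uniq ?iota_uniq// => j k /complexI.
    rewrite /s => /mulfI; rewrite gt_eqF// => /(_ isT) /invr_inj /eqP.
    by rewrite eqr_nat => /eqP[].
  by rewrite size_map size_iota ltnn.
exists (\row_i (s j)%:C%C ^+ (D ^ i)); last first.
  move: hj; rewrite /root horner_sum; congr (_ != 0).
  rewrite mevalE; apply: eq_bigr => m _; rewrite hornerZ hornerXn; congr (_ * _).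
  rewrite -prodrXr; apply: eq_bigr => i _.
  by rewrite mxE -exprM mulnC.
have sj0 : 0 < s j by rewrite divr_gt0.
have sjs : s j <= s0 by rewrite ler_pdivrMr// ler_peMr ?ler1n// ltW.
have sj1 : s j <= 1 by rewrite (le_trans sjs)// ge_min lexx.
have sje : d.+1%:R * s j <= e.
  by rewrite mulrC -ler_pdivlMr// (le_trans sjs)// ge_min lexx orbT.
apply: le_trans sje.
have : 0 <= d.+1%:R * s j by rewrite mulr_ge0// ltW.
move=> ds0; rewrite -(@ler_pXn2r _ 2) ?nnegrE ?eucl_norm_ge0// sqr_eucl_norm.
apply: (@le_trans _ _ (\sum_(i < d) s j ^+ 2)).
  apply: ler_sum => i _; rewrite mxE normcX normc_real ger0_norm ?(ltW sj0)//.
  rewrite lerXn2r ?nnegrE ?exprn_ge0 ?(ltW sj0)//.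
  by rewrite -[leRHS]expr1 ler_wiXn2l ?expn_gt0 ?D0// (ltW sj0).
rewrite sumr_const card_ord [leRHS]exprMn -[leLHS]mulr_natl.
rewrite ler_wpM2r ?sqr_ge0// -natrX ler_nat.
by rewrite (leq_trans (leqnSn d))// -mulnn leq_pmulr.
Qed.

End Line.

(** * The gaussian weight: global maximality and distance to the zeros *)

Section GaussianMaximum.
Variables (R : realType) (d N : nat).
Variables (P : 'I_N -> mpoly d R[i]) (a : 'I_N -> R).
Hypothesis a_gt0 : forall k, 0 < a k.
Implicit Types z w : 'rV[R[i]]_d.

Let weight z : R := wprod a (fun k => meval (z 0) (P k)).

Definition gauss_weight z : R := weight z * expR (- (eucl_norm z ^+ 2 / 2)).

Lemma gauss_weight_argmax (r : R) : 0 <= r ->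
  exists2 z, eucl_norm z <= r &
    forall y, eucl_norm y <= r -> gauss_weight y <= gauss_weight z.
Proof.
move=> r0; apply: ball_argmax => //.
have cw : continuous (fun x : 'rV[R]_(d + d) => weight (complex_row x)).
  apply: (@continuous_wprod R _ N a (fun x k => meval (complex_row x 0) (P k))) => // k.
  exact: ccontinuous_meval (@ccontinuous_complex_row R d).
have cn := continuous_eucl_norm (@ccontinuous_complex_row R d).
apply: continuous_mulr cw (continuous_expR_comp _).
have -> : (fun x : 'rV[R]_(d + d) => - (eucl_norm (complex_row x) ^+ 2 / 2)) =
    (fun x => eucl_norm (complex_row x) * eucl_norm (complex_row x) * (- 2^-1)).
  by apply/funext => x; rewrite mulrN -expr2.
by apply: continuous_mulr (continuous_mulr cn cn) _; exact: cst_continuous.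
Qed.

Lemma wprodM (u v : 'I_N -> R[i]) :
  wprod a (fun k => u k * v k) = wprod a u * wprod a v.
Proof.
rewrite /wprod -big_split; apply: eq_bigr => k _ /=.
by rewrite ComplexField.Normc.normcM powRM ?normc_ge0.
Qed.

Lemma weightE z : weight z = gauss_weight z * expR (eucl_norm z ^+ 2 / 2).
Proof. by rewrite /gauss_weight -mulrA -expRD addNr expR0 mulr1. Qed.

(* Along the complex line through [z] and the origin, [P k] times the power
   [deg P k] of the inverse parameter is a polynomial in that inverse, so the
   maximum principle bounds the growth of [weight] by [|z| ^ (\sum a deg P)]. *)
Lemma gauss_weight_le_outside (r M : R) : 0 < r -> 0 <= M ->
  \sum_(k < N) a k * (total_degree (P k))%:R <= r ^+ 2 ->
  (forall z, eucl_norm z <= r -> gauss_weight z <= M) ->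
  forall z, gauss_weight z <= M.
Proof.
move=> r0 M0 degr ball_le z.
have [/ball_le//|rz] := leP (eucl_norm z) r.
pose l := eucl_norm z / r.
have l1 : 1 < l by rewrite /l ltr_pdivlMr// mul1r.
have l0 : 0 < l by exact: lt_trans ltr01 l1.
have zl : eucl_norm z = l * r by rewrite /l divfK ?gt_eqF.
pose y := (l^-1)%:C%C *: z.
have yr : eucl_norm y = r.
  by rewrite /y eucl_normZ normc_real gtr0_norm ?invr_gt0// zl mulKf ?gt_eqF.
pose n k := total_degree (P k).
(* For s nonzero, q_k(s) = s^(n_k) P_k(y / s): the unit circle corresponds to points of norm r, and
   s = 1 / l to z. *)
pose q k := reverse_poly (n k) (line_poly 0 y (P k)).
have qE s k : s != 0 -> (q k).[s] = s ^+ n k * meval ((s^-1 *: y) 0) (P k).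
  move=> s0; rewrite /q horner_reverse_poly ?horner_line_poly ?add0r//.
  by rewrite (leq_trans (size_line_poly _ _ _))// leqSpred.
have wE s : s != 0 -> wprod a (fun k => (q k).[s]) =
    wprod a (fun k => s ^+ n k) * weight (s^-1 *: y).
  move=> s0; rewrite /weight -wprodM; congr wprod.
  by apply/funext => k; exact: qE.
have wX s : s != 0 -> wprod a (fun k => s ^+ n k) =
    expR (ln (normc s) * \sum_(k < N) a k * (n k)%:R).
  move=> s0; have ns : 0 < normc s by rewrite lt_def normc_ge0 normc_eq0 s0.
  rewrite mulr_sumr expR_sum; apply: eq_bigr => k _.
  rewrite normcX -{1}(lnK ns) -expRM_natl -expRM; congr expR.
  by ring.
have boundary t : normc t = 1 ->
    wprod a (fun k => (q k).[t]) * expR (complex.Re (0 * t)) <= M * expR (r ^+ 2 / 2).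
  move=> t1; have t0 : t != 0 by rewrite -normc_eq0 t1 oner_eq0.
  rewrite mul0r /= expR0 mulr1 wE// wX// t1 ln1 mul0r expR0 mul1r weightE.
  rewrite eucl_normZ ComplexField.Normc.normcV t1 invr1 mul1r yr.
  rewrite ler_wpM2r ?expR_ge0// ball_le// eucl_normZ.
  by rewrite ComplexField.Normc.normcV t1 invr1 mul1r yr.
pose s : R[i] := (l^-1)%:C%C.
have ns : normc s = l^-1 by rewrite normc_real gtr0_norm ?invr_gt0.
have s0 : s != 0 by rewrite -normc_eq0 ns invr_eq0 gt_eqF.
have s1 : normc s <= 1 by rewrite ns invf_le1// ltW.
have Mr0 : 0 <= M * expR (r ^+ 2 / 2) by rewrite mulr_ge0 ?expR_ge0.
have := disc_max a_gt0 ltr01 Mr0 boundary s1.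
rewrite mul0r /= expR0 mulr1 wE// wX// ns lnV ?posrE//.
have -> : s^-1 *: y = z by rewrite scalerA mulVf ?scale1r.
rewrite -ler_pdivlMl ?expR_gt0// -expRN mulNr opprK => wz.
rewrite /gauss_weight -ler_pdivlMr ?expR_gt0// -expRN opprK.
apply: le_trans wz _; rewrite mulrCA ler_wpM2l// -expRD ler_expR zl.
have lnl : 0 <= ln l by rewrite ln_ge0// ltW.
have : ln l * (\sum_(k < N) a k * (n k)%:R) <= ln l * r ^+ 2.
  by rewrite ler_wpM2l.
(* The gaussian absorbs the growth l^(r^2), as r^2 / 2 + r^2 ln l <= (l r)^2 / 2. *)
have : 2 * ln l <= l ^+ 2 - 1.
  rewrite mulr_natl -lnXn// -[X in ln X](subrK 1) addrC le_ln1Dx//.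
  by rewrite ltrBrDl subrr exprn_gt0.
have r2 : 0 < r ^+ 2 by rewrite exprn_gt0.
by nra.
Qed.

(* The factor |t| ^ a k due to the zero [w] is divided out on the disc of
   radius [delta / |z - w|] of the line through [w] and [z]; on its boundary
   [|w + t v|^2] is harmonic up to a constant. *)
Lemma gauss_argmax_dist_zero (k : 'I_N) (delta : R) z w :
  0 < delta -> a k = delta ^+ 2 ->
  (forall y, gauss_weight y <= gauss_weight z) -> 0 < gauss_weight z ->
  meval (w 0) (P k) = 0 -> delta <= eucl_norm (z - w).
Proof.
move=> d0 ak zmax z0 wP; rewrite leNgt; apply/negP => ltd.
pose v := z - w.
set l := eucl_norm _ in ltd.
have wv t : (line_poly w v (P k)).[t] = meval ((w + t *: v) 0) (P k).
  exact: horner_line_poly.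
have wv1 : w + 1 *: v = z by rewrite scale1r addrC subrK.
have weightz : 0 < weight z by rewrite weightE mulr_gt0 ?expR_gt0.
have l0 : 0 < l.
  rewrite lt_def eucl_norm_ge0 andbT; apply: contraTneq weightz => lz.
  have zw : z = w.
    apply/rowP => i; apply/eqP; rewrite -subr_eq0 -normc_eq0 eq_le normc_ge0 andbT.
    by have := normc_le_eucl_norm (z - w) i; rewrite -/l lz !mxE.
  rewrite -leNgt /weight /wprod (bigD1 k)//= zw wP.
  by rewrite ComplexField.Normc.normc0 powR0 ?mul0r// gt_eqF.
pose rho := delta / l.
have rho1 : 1 < rho by rewrite /rho ltr_pdivlMr// mul1r.
have rho0 : 0 < rho by exact: lt_trans ltr01 rho1.
have [g gE] : exists g, line_poly w v (P k) = g * ('X - 0%:P).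
  by apply/factor_theorem; rewrite /root wv scale0r addr0 wP.
pose q j := if j == k then g else line_poly w v (P j).
have qE t : weight (w + t *: v) = wprod a (fun j => (q j).[t]) * normc t `^ a k.
  transitivity (wprod a (fun j => (q j).[t]) *
                wprod a (fun j => if j == k then t else 1)).
    rewrite -wprodM /weight; congr wprod; apply/funext => j.
    rewrite /q; case: eqP => [->|_]; last by rewrite mulr1 horner_line_poly.
    by rewrite -wv gE hornerM hornerXsubC subr0.
  congr (_ * _); rewrite /wprod (bigD1 k)//= eqxx big1 ?mulr1// => j /negbTE ->.
  by rewrite ComplexField.Normc.normc1 powR1.
pose b : R[i] := \sum_(i < d) v 0 i * (w 0 i)^*%C.
(* For |t| = rho, |w + t v|^2 - |z|^2 = 2 Re (b t) - 2 Re b + delta^2 - l^2. Maximality of z,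
   divided by |t|^(a_k) = rho^(a_k), yields this bound. *)
pose M := weight z * expR (- complex.Re b + (delta ^+ 2 - l ^+ 2) / 2 - a k * ln rho).
have M0 : 0 <= M by rewrite mulr_ge0 ?expR_ge0// ltW.
have boundary t : normc t = rho ->
    wprod a (fun j => (q j).[t]) * expR (complex.Re (- b * t)) <= M.
  move=> trho; have := zmax (w + t *: v).
  have -> : gauss_weight z = weight z * expR (- (eucl_norm (w + 1 *: v) ^+ 2 / 2)).
    by rewrite wv1.
  rewrite {1}/gauss_weight -/(weight _) qE trho !sqr_eucl_normD -/b trho.
  rewrite ComplexField.Normc.normc1 expr1n mul1r mulr1 -/l.
  have -> : rho ^+ 2 * l ^+ 2 = delta ^+ 2 by rewrite -exprMn divfK ?gt_eqF.
  have -> : rho `^ a k = expR (a k * ln rho) by rewrite /powR gt_eqF.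
  rewrite -mulrA -expRD -ler_pdivlMr ?expR_gt0// -expRN -mulrA -expRD => le1.
  rewrite -ler_pdivlMr ?expR_gt0// -expRN /M -mulrA -expRD.
  apply: le_trans le1 _; apply: ler_wpM2l; first exact: ltW.
  rewrite ler_expR mulNr raddfN /=.
  by lra.
have n1 : normc (1 : R[i]) <= rho by rewrite ComplexField.Normc.normc1 ltW.
have := disc_max a_gt0 rho0 M0 boundary n1.
have := qE 1; rewrite wv1 ComplexField.Normc.normc1 powR1 mulr1 => <-.
rewrite mulr1 raddfN /= /M ler_pM2l// ler_expR ak.
(* At t = 1 the maximum principle gives delta^2 ln rho <= (delta^2 - l^2) / 2, while the strict
   inequality exp x > 1 + x at x = - 2 ln rho gives the opposite. *)
have ll : l ^+ 2 = delta ^+ 2 * expR (- 2 * ln rho).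
  rewrite mulNr expRN mulr_natl -lnXn// lnK ?posrE ?exprn_gt0//.
  by rewrite /rho expr_div_n invf_div mulrC divfK// expf_neq0// gt_eqF.
have lnrho : 0 < ln rho by rewrite ln_gt0.
have /expR_gt1Dx : - 2 * ln rho != 0.
  by rewrite mulNr oppr_eq0 mulf_neq0// gt_eqF.
have d2 : 0 < delta ^+ 2 by rewrite exprn_gt0.
rewrite -(ltr_pM2l d2) -ll.
by nra.
Qed.

End GaussianMaximum.

Theorem corollary1p4 (R : realType) (d N : nat)
    (P : 'I_N -> mpoly d R[i]) (delta : 'I_N -> R) (r : R)
    (P_neq0 : forall k, P k != 0)
    (delta_gt0 : forall k, 0 < delta k)
    (r_gt0 : 0 < r)
    (sum_le : \sum_(k < N) delta k ^+ 2 * (total_degree (P k))%:R <= r ^+ 2) :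
  exists2 z : 'rV[R[i]]_d, eucl_ball d r z
    & forall k : 'I_N, ((delta k)%:E <= eucl_dist z (zero_set (P k)))%E.
Proof.
have a_gt0 k : 0 < delta k ^+ 2 by rewrite exprn_gt0.
have [z zr zmax] := gauss_weight_argmax P a_gt0 (ltW r_gt0).
exists z => //.
(* A point of the ball where no P_k vanishes shows that the maximum is positive. *)
have P0 : \prod_(k < N) P k != 0 by apply/prodf_neq0.
have [y yr Py] := meval_neq0_near0 P0 r_gt0.
have zP : 0 < gauss_weight P (fun k => delta k ^+ 2) z.
  apply: lt_le_trans (zmax y yr).
  rewrite mulr_gt0 ?expR_gt0// prodr_gt0// => k _.
  rewrite powR_gt0// lt_def normc_ge0 normc_eq0 andbT.
  move: Py; rewrite rmorph_prod => /prodf_neq0 Py; exact: Py.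
have zglobal := gauss_weight_le_outside a_gt0 r_gt0 (ltW zP) sum_le zmax.
move=> k; apply: le_ereal_inf_tmp => _ [w wP <-]; rewrite lee_fin.
exact: (gauss_argmax_dist_zero a_gt0 (delta_gt0 k) _ zglobal zP wP).
Qed.
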